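(* Let $f=\gamma_0+\sum_{i=1}^{t}a_i\gamma_{2i}$ with $a_i\in\mathbb{F}_2$, viewed as a shift-invariant function on $\mathbb{F}_2^n$ for every $n\geq1$. Let $F(X)=1+\sum_{i=1}^ta_iX^i\in\mathbb{F}_2[X]$ and let $F=g_1^{e_1}\cdots g_r^{e_r}$ ($e_j\geq1$) be its factorization into distinct irreducible polynomials. Then $\xi(f)=\{2\,\mathrm{ord}(g_j): j=1,\dots,r\}$; that is, for every $n\geq1$, $f$ fails to be a permutation of $\mathbb{F}_2^n$ if and only if $n$ is a multiple of $2\,\mathrm{ord}(g_j)$ for some $j$. In particular $\xi(f)$ is finite and $\mathrm{inv}(f)$ is infinite.
   Context: For $n\geq1$ let $\mathbbm{1}=(1,\dots,1)\in\mathbb{F}_2^n$, let $\odot$ denote component-wise multiplication in $\mathbb{F}_2^n$, and let $S(x_1,\dots,x_n)=(x_2,\dots,x_n,x_1)$. Define $\gamma_0=\mathrm{id}$ and, for $k\geq1$, $\gamma_{2k}(x)=S^{2k}(x)\odot(\mathbbm{1}+S^{2k-1}(x))\odot(\mathbbm{1}+S^{2k-3}(x))\odot\cdots\odot(\mathbbm{1}+S(x))$ on $\mathbb{F}_2^n$ (indices of $S$ taken mod $n$); sums are pointwise. For such a function $f$, $\mathrm{inv}(f)=\{n\in\mathbb{N}: f \text{ is a permutation of } \mathbb{F}_2^n\}$, and $\xi(f)$ denotes a set of positive integers generating the complement, i.e. $n\notin\mathrm{inv}(f)$ iff $n$ is a multiple of some element of $\xi(f)$. For $g\in\mathbb{F}_2[X]$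 with $g(0)=1$, $\mathrm{ord}(g)$ is the least $\ell\geq1$ with $g\mid X^\ell+1$. *)

(* Defs.v *)
From HB Require Import structures.
From mathcomp Require Import all_boot all_order all_algebra.
From mathcomp Require Import boolp classical_sets functions cardinality.

Set Implicit Arguments.
Unset Strict Implicit.
Unset Printing Implicit Defensive.

Import GRing.Theory.
Local Open Scope ring_scope.

(* F_2^n; the library's ring structure on finite functions is component-wise,
   so that 1 is the all-ones vector and * is the component-wise product. *)
Notation vecF2 n := {ffun 'I_n -> 'F_2}.

Definition shift n (x : vecF2 n) : vecF2 n := [ffun i => x (ordS i)].

(* [gamma2 k] is gamma_{2k}; for k = 0 the product is empty and the formula
   gives the identity (lemma [gamma2_0]). *)
Definition gamma2 k n (x : vecF2 n) : vecF2 n :=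
  iter (2 * k) (@shift n) x *
  \prod_(1 <= j < k.+1) (1 + iter (2 * j).-1 (@shift n) x).

Lemma gamma2_0 n : @gamma2 0 n =1 id.
Proof. by move=> x; rewrite /gamma2 big_geq // mulr1. Qed.

(* [a i] is used for 1 <= i <= t only. *)
Definition gamma_sum t (a : nat -> 'F_2) n (x : vecF2 n) : vecF2 n :=
  [ffun l => gamma2 0 x l + \sum_(1 <= i < t.+1) a i * gamma2 i x l].

Definition gamma_poly t (a : nat -> 'F_2) : {poly 'F_2} :=
  1 + \sum_(1 <= i < t.+1) a i *: 'X^i.

Definition inv_set (f : forall n, vecF2 n -> vecF2 n) : set nat :=
  [set n | (0 < n)%N /\ bijective (f n)]%classic.

(* A generating set of the complement of inv(f) is not unique, so that
   "xi(f) = D" is the relation [is_xi f D]. *)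
Definition is_xi (f : forall n, vecF2 n -> vecF2 n) (D : set nat) : Prop :=
  (forall m, D m -> (0 < m)%N) /\
  (forall n, (0 < n)%N -> (~ inv_set f n <-> exists2 m, D m & (m %| n)%N)).

Lemma poly_ord_subproof (g : {poly 'F_2}) :
  exists l, (g.[0] == 1) ==> (0 < l)%N && (g %| 'X^l + 1).
Proof.
have [g01|_] := boolP (g.[0] == 1); last by exists 0%N.
have g0 : g != 0.
  by apply: contraTneq g01 => ->; rewrite horner0 eq_sym oner_eq0.
pose h (i : 'I_(#|{: {ffun 'I_(size g) -> 'F_2}}|).+1) :
  {ffun 'I_(size g) -> 'F_2} := [ffun k : 'I_(size g) => ('X^i %% g)`_k].
have /injectivePn [i [j nij hij]] : ~~ injectiveb h.
  by apply/negP => /injectiveP/leq_card; rewrite card_ord ltnn.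
have {hij} mij : 'X^i %% g = 'X^j %% g :> {poly 'F_2}.
  apply/polyP => k; have [kg|gk] := ltnP k (size g).
    by have /ffunP/(_ (Ordinal kg)) := hij; rewrite !ffunE.
  by rewrite !nth_default // (leq_trans _ gk) // ltnW // ltn_modp.
have {h nij mij} [m [n [mn mE]]] : exists m n : nat,
    (m < n)%N /\ 'X^m %% g = 'X^n %% g :> {poly 'F_2}.
  have : (i : nat) != j by [].
  by rewrite neq_ltn => /orP[ij|ji]; [exists i, j|exists j, i].
exists (n - m)%N; rewrite subn_gt0 mn /=.
have cgX : coprimep g ('X^m).
  rewrite coprimep_expr // -['X]subr0 -polyC0 coprimep_XsubC.
  by rewrite /root (eqP g01) oner_eq0.
rewrite -(Gauss_dvdpr _ cgX) mulrDr mulr1 -exprD subnKC 1?ltnW //.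
rewrite /dvdp modpD mE -mulr2n -mulr_natr.
have -> : 2%:R = 0 :> {poly 'F_2}.
  by rewrite -polyC_natr; apply/eqP; rewrite polyC_eq0.
by rewrite mulr0.
Qed.

(* ord(g) for g(0) = 1; the junk value for g(0) <> 1 is 0. *)
Definition poly_ord (g : {poly 'F_2}) : nat := ex_minn (poly_ord_subproof g).

Lemma poly_ordP (g : {poly 'F_2}) : g.[0] = 1 ->
  [/\ (0 < poly_ord g)%N, g %| 'X^(poly_ord g) + 1 &
      forall l, (0 < l)%N -> g %| 'X^l + 1 -> (poly_ord g <= l)%N].
Proof.
move=> g01; rewrite /poly_ord; case: ex_minnP => l.
rewrite g01 eqxx /= => /andP[l0 gl] lmin; split=> // m m0 gm.
by apply: lmin; rewrite m0 gm.
Qed.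

(* Main.v *)
(** Write [gamma_comb p] for the sum of the [p`_i gamma_{2i}]. If [q(0) = 1],
    then [gamma_comb p \o gamma_comb q = gamma_comb (p * q)], because
    [gamma_{2i+2}(x)] and [S (gamma_{2j}(x))] have disjoint supports.
    On [F_2^n], [gamma_comb] kills the multiples of ['X^(m+1)] if [n = 2m+1],
    and those of ['X^m * ('X^m + 1)] if [n = 2m]; when [F] is coprime to that
    polynomial, a Bezout relation gives an inverse of [gamma_comb F].
    Conversely, on vectors supported on the even positions of [F_2^(2m)],
    [gamma_comb] is the action of polynomials in the double shift, which has
    order [m], so a common factor of [F] and ['X^m + 1] gives a kernel. *)
Require Import Defs.
From HB Require Import structures.
From mathcomp Require Import all_boot all_order all_algebra.
From mathcomp Require Import boolp classical_sets functions cardinality.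

Set Implicit Arguments.
Unset Strict Implicit.
Unset Printing Implicit Defensive.

Import GRing.Theory.
Local Open Scope classical_set_scope.
Local Open Scope ring_scope.

(** * The shift and the Boolean ring of vectors *)

Lemma shiftD n (u v : vecF2 n) : shift (u + v) = shift u + shift v.
Proof. by apply/ffunP => i; rewrite !ffunE. Qed.

Lemma shiftM n (u v : vecF2 n) : shift (u * v) = shift u * shift v.
Proof. by apply/ffunP => i; rewrite !ffunE. Qed.

Lemma shift0 n : shift (0 : vecF2 n) = 0.
Proof. by apply/ffunP => i; rewrite !ffunE. Qed.

Lemma shift1 n : shift (1 : vecF2 n) = 1.
Proof. by apply/ffunP => i; rewrite !ffunE. Qed.

Lemma shift_prod n I (r : seq I) (F : I -> vecF2 n) :
  shift (\prod_(i <- r) F i) = \prod_(i <- r) shift (F i).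
Proof. exact: (big_morph _ (@shiftM n) (@shift1 n)). Qed.

Lemma iter_shiftE n k (x : vecF2 n) i :
  iter k (@shift n) x i = x (iter k (@ordS n) i).
Proof. by elim: k i => //= k IHk i; rewrite ffunE IHk -iterSr. Qed.

Lemma val_iter_ordS n k (i : 'I_n) :
  iter k (@ordS n) i = ((i + k) %% n)%N :> nat.
Proof.
elim: k => [|k /= ->]; first by rewrite addn0 modn_small.
by rewrite -addn1 modnDml addn1 addnS.
Qed.

Lemma iter_shift_period n (x : vecF2 n) : iter n (@shift n) x = x.
Proof.
apply/ffunP => i; rewrite iter_shiftE; congr (x _); apply: val_inj.
by rewrite /= val_iter_ordS modnDr modn_small.
Qed.

Lemma vecF2_idem n (u : vecF2 n) : u * u = u.
Proof.
by apply/ffunP => i; rewrite !ffunE; case: (u i) => -[|[|//]] ?; apply: val_inj.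
Qed.

Lemma vecF2_addxx n (u : vecF2 n) : u + u = 0.
Proof.
by apply/ffunP => i; rewrite !ffunE; case: (u i) => -[|[|//]] ?; apply: val_inj.
Qed.

Lemma vecF2_mulC n : commutative (@GRing.mul (vecF2 n)).
Proof. by move=> u v; apply/ffunP => i; rewrite !ffunE mulrC. Qed.

Lemma vecF2_mulCA n : left_commutative (@GRing.mul (vecF2 n)).
Proof. by move=> u v w; rewrite !mulrA (vecF2_mulC u). Qed.

Lemma vecF2_mulAC n : right_commutative (@GRing.mul (vecF2 n)).
Proof. by move=> u v w; rewrite -!mulrA (vecF2_mulC v). Qed.

Lemma vecF2_mulNx n (u : vecF2 n) : (1 + u) * u = 0.
Proof. by rewrite mulrDl mul1r vecF2_idem vecF2_addxx. Qed.

(** * The maps gamma_{2k} as an orbit *)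

(** For fixed [x] this is additive in [v], so the nonlinear maps gamma_{2k} become iterates of a
    linear operator started at [x]. It plays the role of multiplication by ['X]. *)
Definition gamma_step n (x v : vecF2 n) : vecF2 n :=
  (1 + shift x) * shift (shift v).

Lemma gamma_step0 n (x : vecF2 n) : gamma_step x 0 = 0.
Proof. by rewrite /gamma_step !shift0 mulr0. Qed.

Lemma gamma2S n k (x : vecF2 n) : gamma2 k.+1 x = gamma_step x (gamma2 k x).
Proof.
rewrite /gamma2 /gamma_step !shiftM !shift_prod vecF2_mulCA.
have -> : (2 * k.+1 = (2 * k).+2)%N by rewrite mulnS.
congr (_ * _).
rewrite big_nat_recl //; congr (_ * _).
apply: eq_big_nat => -[//|i] _.
by rewrite !shiftD !shift1 !mulnS.
Qed.

Lemma gamma2_iter n k (x : vecF2 n) : gamma2 k x = iter k (gamma_step x) x.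
Proof. by elim: k => [|k IHk]; rewrite ?gamma2_0 // gamma2S IHk. Qed.

Lemma iter_gamma_step n k (x v : vecF2 n) :
  iter k (gamma_step x) v =
  \prod_(j < k) (1 + iter (2 * j).+1 (@shift n) x) * iter (2 * k) (@shift n) v.
Proof.
elim: k => [|k IHk]; first by rewrite big_ord0 mul1r.
have -> : (2 * k.+1 = (2 * k).+2)%N by rewrite mulnS.
rewrite iterS IHk big_ord_recl /gamma_step !shiftM !shift_prod mulrA.
congr (_ * _ * _); apply: eq_bigr => i _.
by rewrite !shiftD !shift1 lift0 mulnS.
Qed.

(* Two neighbouring windows clash: the 1-entry required by one of the two
   factors is required to be a 0-entry by the other. *)
Lemma gamma2S_shift n i j (x : vecF2 n) :
  gamma2 i.+1 x * shift (gamma2 j x) = 0.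
Proof.
elim: j i => [|j IHj] i.
  by rewrite gamma2S gamma2_0 /gamma_step vecF2_mulAC vecF2_mulNx mul0r.
rewrite !(gamma2S _ x) /gamma_step shiftM shiftD shift1.
case: i => [|i]; rewrite ?gamma2_0.
  by rewrite -mulrA [shift (shift x) * _]mulrA [shift (shift x) * _]vecF2_mulC
             vecF2_mulNx mul0r mulr0.
by rewrite vecF2_mulCA -(mulrA _ (shift (shift _))) -!shiftM IHj !shift0 !mulr0.
Qed.

(** * Polynomials acting on vectors, and composition *)

Definition gamma_comb (p : {poly 'F_2}) n (x : vecF2 n) : vecF2 n :=
  [ffun l => \sum_(i < size p) p`_i * gamma2 i x l].

Implicit Types p q g : {poly 'F_2}.

(** Lets polynomials of different sizes be summed over a common range. *)
Lemma gamma_combE p n (x : vecF2 n) N l : (size p <= N)%N ->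
  gamma_comb p x l = \sum_(i < N) p`_i * gamma2 i x l.
Proof.
move=> pN; rewrite ffunE (big_ord_widen _ (fun i => p`_i * gamma2 i x l) pN).
rewrite big_mkcond; apply: eq_bigr => i _.
by case: ltnP => // /(nth_default 0) ->; rewrite mul0r.
Qed.

Lemma gamma_combD p q n (x : vecF2 n) :
  gamma_comb (p + q) x = gamma_comb p x + gamma_comb q x.
Proof.
apply/ffunP => l; rewrite [RHS]ffunE.
rewrite !(@gamma_combE _ _ _ (maxn (size p) (size q)))
  ?leq_maxl ?leq_maxr ?size_polyD //.
by rewrite -big_split; apply: eq_bigr => i _; rewrite coefD mulrDl.
Qed.

Lemma gamma_comb0 n (x : vecF2 n) : gamma_comb 0 x = 0.
Proof. by apply/ffunP => l; rewrite !ffunE size_poly0 big_ord0. Qed.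

Lemma gamma_combZ c p n (x : vecF2 n) l :
  gamma_comb (c *: p) x l = c * gamma_comb p x l.
Proof.
rewrite !(@gamma_combE _ _ _ (size p)) ?size_scale_leq // mulr_sumr.
by apply: eq_bigr => i _; rewrite coefZ mulrA.
Qed.

Lemma gamma_combXn k n (x : vecF2 n) : gamma_comb 'X^k x = gamma2 k x.
Proof.
apply/ffunP => l; rewrite ffunE size_polyXn big_ord_recr big1 /=.
  by rewrite coefXn eqxx add0r mul1r.
by move=> i _; rewrite coefXn ltn_eqF // mul0r.
Qed.

Lemma gamma_comb1 n (x : vecF2 n) : gamma_comb 1 x = x.
Proof. by rewrite -(expr0 'X) gamma_combXn gamma2_0. Qed.

Lemma gamma_combC c n (x : vecF2 n) l : gamma_comb c%:P x l = c * x l.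
Proof. by rewrite -alg_polyC gamma_combZ gamma_comb1. Qed.

Lemma gamma_combMX p n (x : vecF2 n) :
  gamma_comb (p * 'X) x = gamma_step x (gamma_comb p x).
Proof.
apply/ffunP => l; rewrite (@gamma_combE _ _ _ (size p).+1); last first.
  by rewrite (leq_trans (size_polyMleq _ _)) // size_polyX addn2.
rewrite big_ord_recl coefMX mul0r add0r !ffunE mulr_sumr.
apply: eq_bigr => i _; rewrite coefMX /= /bump /= add1n /= gamma2S !ffunE.
exact: mulrCA.
Qed.

Lemma gamma_combMXn p k n (x : vecF2 n) :
  gamma_comb (p * 'X^k) x = iter k (gamma_step x) (gamma_comb p x).
Proof.
elim: k => [|k IHk]; first by rewrite mulr1.
by rewrite exprSr mulrA gamma_combMX IHk.
Qed.

Lemma gamma_combMX_shift p q n (x : vecF2 n) :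
  gamma_comb (p * 'X) x * shift (gamma_comb q x) = 0.
Proof.
rewrite gamma_combMX; apply/ffunP => l.
rewrite /gamma_step !ffunE mulr_sumr big1 // => j _.
rewrite mulr_sumr mulr_suml big1 // => i _.
have /ffunP/(_ l) := gamma2S_shift i j x.
rewrite gamma2S /gamma_step !ffunE => E.
by rewrite (mulrCA _ p`_i) mulrACA E mulr0.
Qed.

(** Writing [q] as a multiple of ['X] plus 1, the multiple of ['X] only adds a shifted instance of
    [gamma_combMX_shift], which vanishes. *)
Lemma gamma_step_comb p q n (x : vecF2 n) : q`_0 = 1 ->
  gamma_step (gamma_comb q x) (gamma_comb p x) = gamma_step x (gamma_comb p x).
Proof.
elim/poly_ind: q => [|q c _].
  by rewrite coef0 => /esym/eqP; rewrite oner_eq0.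
rewrite coefD coefMX coefC add0r => -> /=.
rewrite /gamma_step gamma_combD gamma_comb1 shiftD addrCA mulrDl -shiftM.
by rewrite gamma_combMX_shift shift0 add0r.
Qed.

(** Horner induction on [p]: each step taken at the base point [gamma_comb q x] may be taken at [x]
    instead. *)
Lemma gamma_comb_comp p q n (x : vecF2 n) : q`_0 = 1 ->
  gamma_comb p (gamma_comb q x) = gamma_comb (p * q) x.
Proof.
move=> q0; elim/poly_ind: p => [|p c IHp]; first by rewrite mul0r !gamma_comb0.
rewrite gamma_combD gamma_combMX IHp gamma_step_comb // mulrDl gamma_combD.
rewrite mulrAC gamma_combMX mul_polyC; congr (_ + _).
by apply/ffunP => l; rewrite gamma_combC gamma_combZ.
Qed.

Lemma gamma_comb_inj p q n : p`_0 = 1 -> coprimep p q ->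
  (forall r (x : vecF2 n), gamma_comb (r * q) x = 0) ->
  injective (@gamma_comb p n).
Proof.
move=> p0 /Bezout_eq1_coprimepP[[u v] /= uv] q0.
apply: (can_inj (g := @gamma_comb u n)) => x.
rewrite gamma_comb_comp // -[LHS]addr0 -(q0 v x) -gamma_combD uv.
exact: gamma_comb1.
Qed.

(** * Annihilating polynomials in odd and even length *)

Lemma gamma_combMXn_odd m r (x : vecF2 m.*2.+1) :
  gamma_comb (r * 'X^(m.+1)) x = 0.
Proof.
(* In length 2m+1 the power S^(2m+2) equals S, so S(x) meets the factor 1 + S(x). *)
have gm0 : gamma2 m.+1 x = 0.
  rewrite gamma2_iter iter_gamma_step mul2n doubleS iterS.
  by rewrite iter_shift_period big_ord_recl /= vecF2_mulAC vecF2_mulNx mul0r.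
elim/poly_ind: r => [|r c IHr]; first by rewrite mul0r gamma_comb0.
rewrite mulrDl gamma_combD mulrAC gamma_combMX IHr gamma_step0 add0r.
by apply/ffunP => l; rewrite mul_polyC gamma_combZ gamma_combXn gm0 !ffunE mulr0.
Qed.

(** Since S^(2m) is the identity, m steps amount to multiplication by a fixed vector. This vector is
    idempotent, so 2m steps have the same effect as m. *)
Lemma gamma_combMXn_even m r (x : vecF2 m.*2) :
  gamma_comb (r * ('X^m * ('X^m + 1))) x = 0.
Proof.
rewrite mulrDr mulr1 mulrDr gamma_combD mulrA !gamma_combMXn !iter_gamma_step.
rewrite mul2n !iter_shift_period mulrA vecF2_idem.
exact: vecF2_addxx.
Qed.

(** * The polynomial attached to f *)

Lemma gamma_sumE t a n : @gamma_sum t a n =1 @gamma_comb (gamma_poly t a) n.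
Proof.
move=> x; apply/ffunP => l; rewrite ffunE /gamma_poly gamma_combD gamma_comb1.
rewrite gamma2_0 [RHS]ffunE; congr (_ + _).
elim: t => [|t IHt]; first by rewrite !big_geq // gamma_comb0 ffunE.
rewrite big_nat_recr // [in RHS]big_nat_recr //= gamma_combD IHt [RHS]ffunE.
by rewrite gamma_combZ gamma_combXn.
Qed.

Lemma coef0_gamma_poly t a : (gamma_poly t a)`_0 = 1.
Proof.
rewrite coefD coef1 coef_sum big_nat big1 ?addr0 // => i /andP[i0 _].
by rewrite coefZ coefXn eq_sym gtn_eqF // mulr0.
Qed.

(** * A nontrivial kernel in even length *)

Lemma F2_eq1 (c : 'F_2) : c != 0 -> c = 1.
Proof. by case: c => -[|[|//]] ? // _; apply: val_inj. Qed.

Lemma gamma_comb_vec0 p n : gamma_comb p (0 : vecF2 n) = 0.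
Proof.
apply/ffunP => l; rewrite !ffunE big1 // => i _; rewrite gamma2_iter.
rewrite (_ : iter i _ _ = 0) ?ffunE ?mulr0 //.
by elim: {l} (i : nat) => //= k ->; rewrite gamma_step0.
Qed.

Lemma coef0_XnD1 m : (0 < m)%N -> ('X^m + 1 : {poly 'F_2})`_0 = 1.
Proof. by move=> m0; rewrite coefD coefXn coef1 ltn_eqF // add0r. Qed.

(* The witness is [gamma_comb h] at the delta vector, where [h * g = 'X^m + 1]:
   the operator [gamma_step] of the delta vector has order [m] on it. *)
Lemma gamma_comb_not_inj m p g : (0 < m)%N -> (1 < size g)%N ->
  g %| p -> g %| 'X^m + 1 -> ~ injective (@gamma_comb p m.*2).
Proof.
move=> m0 g1 /dvdpP[p' pE] /dvdpP[h hE] inj.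
have h0 : h`_0 = 1.
  apply: F2_eq1; apply/eqP => h0; have := coef0_XnD1 m0.
  by rewrite hE coef0M h0 mul0r => /esym/eqP; rewrite oner_eq0.
(* As [g] is not constant, [h] has degree below [m]; the shifts by 2i that occur below then do not
   wrap around. *)
have sh : (size h <= m)%N.
  have h_neq0 : h != 0.
    apply/eqP => h00; move: h0; rewrite h00 coef0 => /esym/eqP.
    by rewrite oner_eq0.
  have g_neq0 : g != 0 by rewrite -size_poly_gt0 ltnW.
  have := congr1 (fun q : {poly _} => size q) hE.
  rewrite -polyC1 size_XnaddC // size_mul //.
  move: g1; case: (size g) => [|[|k]] // _.
  by rewrite !addnS /= => -[->]; rewrite leq_addr.
have m2 : (0 < m.*2)%N by rewrite double_gt0.
pose o : 'I_m.*2 := Ordinal m2.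
pose x : vecF2 m.*2 := [ffun i => (i == o)%:R].
(* Odd shifts of [x] live on odd positions because the length is even, so every factor 1 +
   S^(2j+1)(x) fixes [x]. *)
have xm : iter m (gamma_step x) x = x.
  rewrite iter_gamma_step mul2n iter_shift_period.
  apply: (big_ind (fun u : vecF2 _ => u * x = x)); first exact: mul1r.
    by move=> u v ux vx; rewrite -mulrA vx.
  move=> j _; rewrite mulrDl mul1r -[RHS]addr0; congr (_ + _).
  apply/ffunP => i; rewrite ffunE iter_shiftE !ffunE.
  have [->|] := eqVneq i o; last by rewrite mulr0.
  case: eqP => [/(congr1 (@nat_of_ord _))|]; last by rewrite mul0r.
  rewrite val_iter_ordS /= add0n => /(congr1 odd).
  by rewrite odd_mod ?odd_double //= oddM.
have combhx : gamma_comb h x = 0.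
  apply: inj; rewrite gamma_comb_vec0 gamma_comb_comp // pE.
  rewrite -mulrA [g * h]mulrC -hE -gamma_comb_comp ?coef0_XnD1 //.
  rewrite gamma_combD gamma_combXn gamma2_iter xm.
  by rewrite gamma_comb1 vecF2_addxx gamma_comb_vec0.
have /ffunP/(_ o) := combhx; rewrite (gamma_combE _ _ sh) ffunE.
rewrite (bigD1 (Ordinal m0)) //= gamma2_0 h0 ffunE eqxx mulr1 big1 ?addr0.
  by move/eqP; rewrite oner_eq0.
move=> i i0; rewrite gamma2_iter iter_gamma_step [X in _ * X]ffunE.
rewrite iter_shiftE [x _]ffunE.
case: eqP => [/(congr1 (@nat_of_ord _))|]; last by rewrite !mulr0.
rewrite val_iter_ordS /= add0n mul2n modn_small ?ltn_double // => /eqP.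
by rewrite double_eq0 => /eqP E; case/eqP: i0; apply: val_inj.
Qed.

(** * Divisibility by the order *)

Lemma polyF2_oppr (p : {poly 'F_2}) : - p = p.
Proof.
by apply/polyP => i; rewrite coefN; apply: oppr_pchar2; exact: pchar_Fp.
Qed.

Lemma poly_ord_dvd g l : g.[0] = 1 -> (g %| 'X^l + 1) = (poly_ord g %| l)%N.
Proof.
move=> /poly_ordP[]; set o := poly_ord g => o0 go omin.
(* Modulo [g] the power ['X^o] is 1, so only the exponent modulo [o] matters; a nonzero remainder
   would contradict minimality. *)
have gX k r : (g %| 'X^(k * o + r) + 1) = (g %| 'X^r + 1).
  have -> : 'X^(k * o + r) + 1 =
      'X^r * ('X^(k * o) - 1) + ('X^r + 1) :> {poly 'F_2}.
    by rewrite mulrBr mulr1 -exprD addrA subrK addnC.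
  rewrite dvdp_addr // dvdp_mull // mulnC exprM subrX1 dvdp_mulr //.
  by rewrite polyF2_oppr.
rewrite (divn_eq l o) gX dvdn_addr ?dvdn_mull //.
have [->|r0] := posnP (l %% o)%N.
  by rewrite dvdn0 expr0 -[X in _ + X]polyF2_oppr subrr dvdp0.
rewrite gtnNdvd // ?ltn_pmod //; apply/negP => /(omin _ r0).
by rewrite leqNgt ltn_pmod.
Qed.

(** * The characterization of the lengths where f is not bijective *)

Theorem theorem12 (t : nat) (a : nat -> 'F_2)
    (r : nat) (g : 'I_r -> {poly 'F_2}) (e : 'I_r -> nat)
    (g_irr : forall j, irreducible_poly (g j))
    (g_inj : injective g)
    (e_gt0 : forall j, (1 <= e j)%N)
    (factF : gamma_poly t a = \prod_(j < r) g j ^+ e j) :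
  let f := @gamma_sum t a in
  let xi := [set (2 * poly_ord (g j))%N | j in [set: 'I_r]] in
  [/\ is_xi f xi,
      forall n : nat, (1 <= n)%N ->
        (~ bijective (f n) <-> exists j : 'I_r, (2 * poly_ord (g j) %| n)%N),
      finite_set xi
    & infinite_set (inv_set f)].
Proof.
move=> f xi.
have F0 : (gamma_poly t a)`_0 = 1 by exact: coef0_gamma_poly.
have gF j : g j %| gamma_poly t a.
  by rewrite factF (bigD1 j) //= dvdp_mulr // dvdp_exp // dvdpp.
have g0 j : (g j).[0] = 1.
  apply: F2_eq1; apply/eqP => gj0; have /dvdpP[q qE] := gF j.
  move: F0; rewrite -horner_coef0 qE hornerM gj0 mulr0 => /esym/eqP.
  by rewrite oner_eq0.
have bijE n : bijective (f n) <-> injective (@gamma_comb (gamma_poly t a) n).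
  split=> [/bij_inj finj|cinj].
    by apply: eq_inj finj _; exact: gamma_sumE.
  by apply: injF_bij; apply: eq_inj cinj _ => x; rewrite /f gamma_sumE.
have coXm m : coprimep (gamma_poly t a) 'X^m.
  rewrite coprimep_expr // -['X]subr0 -polyC0 coprimep_XsubC.
  by rewrite /root horner_coef0 F0 oner_eq0.
have bij_odd m : bijective (f m.*2.+1).
  apply/bijE; apply: (gamma_comb_inj F0 (coXm m.+1)) => q x.
  exact: gamma_combMXn_odd.
have notbijE n : (1 <= n)%N ->
    (~ bijective (f n) <-> exists j : 'I_r, (2 * poly_ord (g j) %| n)%N).
  move=> n0; have := odd_double_half n; case: (odd n) => /= nE.
    rewrite -nE; split=> [[]|[j]]; first exact: bij_odd.
    by move=> /dvdnP[q] /(congr1 odd); rewrite mulnCA mul2n add1n /= !odd_double.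
  move: n0; rewrite -nE; move: (n./2) => m.
  rewrite add0n double_gt0 => m0; rewrite bijE; split=> [ninj|[j]].
    apply: contrapT => nj; apply: ninj.
    apply: (@gamma_comb_inj _ ('X^m * ('X^m + 1)) _ F0); last first.
      by move=> q x; exact: gamma_combMXn_even.
    (* An irreducible [g j] that is not coprime to ['X^m + 1] divides it, so its order divides [m],
       against [nj]. *)
    rewrite coprimepMr coXm factF /=.
    apply: (big_ind (fun p => coprimep p ('X^m + 1))) => [|p q cp cq|j _].
    - exact: coprime1p.
    - by rewrite coprimepMl cp.
    - apply: coprimep_expl; rewrite irreducible_poly_coprime //.
      rewrite poly_ord_dvd //; apply/negP => om; apply: nj; exists j.
      by rewrite -mul2n dvdn_pmul2l.
  rewrite -mul2n dvdn_pmul2l // -poly_ord_dvd // mul2n => gm.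
  by apply: gamma_comb_not_inj gm => //; case: (g_irr j).
split=> //.
- split=> [_ [j _ <-]|n n0].
    by have [o0 _ _] := poly_ordP (g0 j); rewrite muln_gt0.
  have -> : (~ inv_set f n) = (~ bijective (f n)).
    by congr (~ _); apply/propext; split=> [[]|].
  rewrite notbijE //; split=> [[j jn]|[_ [j _ <-] jn]]; last by exists j.
  by exists (2 * poly_ord (g j))%N => //; exists j.
- exact: finite_image.
- move=> /finite_seqP[s sE].
  (* All odd lengths are in [inv_set f]; this one exceeds the sum of the supposed finite list, hence
     each of its members. *)
  have : inv_set f (\sum_(i <- s) i).*2.+1 by split.
  rewrite sE /= => ins.
  have : ((\sum_(i <- s) i).*2.+1 <= \sum_(i <- s) i)%N.
    by rewrite [leqRHS](big_rem _ ins) leq_addr.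
  by rewrite -addnn -addnS leqNgt -addSnnS leq_addr.
Qed.
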